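(* Let $n$ be a positive integer, let $\zeta_n$ be a primitive $n$-th root of unity, and let $u_1,u_2,u_3$ be formal variables. Then $$\sum_{k,l,s\geq 0}G_n^t(k,l,s;\zeta_n)\,u_1^{k-l-s}u_2^{l-s}u_3^s=\frac{U_n^{t-1}(u_1,u_2,u_3)}{U_n^t(u_1,u_2,u_3)},$$ where $$U_n^t(u_1,u_2,u_3)=\sum_{\substack{a,b\geq 0\\ a+b\leq n-1}}\frac{1}{n-a-b}\binom{n-a-1}{b}\binom{n-b-1}{a}\,t^{n-a-b-1}(1+u_1)^a(1-tu_2)^b(u_3-u_1u_2)^{n-a-b-1},$$ and $U_n^{t-1}$ is obtained from $U_n^t$ by replacing $t$ with $t-1$.
   Context: $\mathbb{N}$ is the set of positive integers and $t$ is a formal parameter. For a multi-index $\mathbf{k}=(k_1,\ldots,k_l)\in\mathbb{N}^l$ define the weight $\mathrm{wt}(\mathbf{k})=k_1+\cdots+k_l$, the depth $\mathrm{dep}(\mathbf{k})=l$, and the height ($1$-height) $\#\{j\mid k_j\geq 2\}$. Let $q$ be a complex number with $q^m\ne1$ for every positive integer $m<n$ (e.g. $q=\zeta_n$). For $\mathbf{k}\in\mathbb{N}^l$ with $l\ge 1$, $$\overline{z}_n(\mathbf{k};q)=\sum_{n>m_1>\cdots>m_l>0}\frac{q^{(k_1-1)m_1+\cdots+(k_l-1)m_l}}{(1-q^{m_1})^{k_1}\cdots(1-q^{m_l})^{k_l}},$$ and its interpolated version is $$\overline{z}_n^t(\mathbf{k};q)=\sum_{\mathbf{p}}\overline{z}_n(\mathbf{p};q)\,t^{l-\mathrm{dep}(\mathbf{p})},$$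 where the sum runs over all $3^{l-1}$ ways of forming $\mathbf{p}=(k_1\Box\cdots\Box k_l)$ by filling each $\Box$ with '','' (comma), ''$+$'' or ''$-1+$''. For nonnegative integers $k,l,s$, $G_n^t(k,l,s;q)$ is the sum of $\overline{z}_n^t(\mathbf{k};q)$ over all multi-indices $\mathbf{k}$ of weight $k$, depth $l$ and height $s$; it is $0$ when there are no such multi-indices, except that $G_n^t(0,0,0;q)=1$. The identity is one of formal power series in $u_1,u_2,u_3$. *)

(* Defs.v *)
From HB Require Import structures.
From mathcomp Require Import all_boot all_algebra.
From mathcomp Require Import boolp classical_sets functions cardinality fsbigop.
From mathcomp Require Import zify.

Set Implicit Arguments.
Unset Strict Implicit.
Unset Printing Implicit Defensive.

Import GRing.Theory.

Local Open Scope ring_scope.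

(* R[[x]], as a commutative unit ring whose units are the series with an      *)
(* invertible constant term. As in any unitRingType, x / y is only meaningful *)
(* when y is a unit.                                                          *)
Record fps (R : Type) := Fps { fcoef : nat -> R }.

Lemma fpsP (R : Type) (x y : fps R) : fcoef x =1 fcoef y -> x = y.
Proof. by case: x y => [f] [g] /= /funext ->. Qed.

HB.instance Definition _ (R : Type) := gen_eqMixin (fps R).
HB.instance Definition _ (R : Type) := gen_choiceMixin (fps R).

Section FpsRing.
Variable R : comNzRingType.
Implicit Types x y z : fps R.

Definition fps_add x y := Fps (fun i => fcoef x i + fcoef y i).
Definition fps_opp x := Fps (fun i => - fcoef x i).
Definition fps_const (c : R) := Fps (fun i => if i == 0%N then c else 0).
Definition fps_var : fps R := Fps (fun i => (i == 1%N)%:R).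
Definition fps_mul x y :=
  Fps (fun n => \sum_(i < n.+1) fcoef x i * fcoef y (n - i)).

Lemma fps_addA : associative fps_add.
Proof. by move=> x y z; apply: fpsP => i /=; rewrite addrA. Qed.
Lemma fps_addC : commutative fps_add.
Proof. by move=> x y; apply: fpsP => i /=; rewrite addrC. Qed.
Lemma fps_add0 : left_id (fps_const 0) fps_add.
Proof. by move=> x; apply: fpsP => i /=; rewrite if_same add0r. Qed.
Lemma fps_addN : left_inverse (fps_const 0) fps_opp fps_add.
Proof. by move=> x; apply: fpsP => i /=; rewrite if_same addNr. Qed.

HB.instance Definition _ := GRing.isZmodule.Build (fps R)
  fps_addA fps_addC fps_add0 fps_addN.

Definition fps_trunc n x : {poly R} := \poly_(i < n) fcoef x i.

Lemma fps_mul_trunc n i x y : (i < n)%N ->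
  fcoef (fps_mul x y) i = (fps_trunc n x * fps_trunc n y)`_i.
Proof.
move=> lt_in; rewrite coefM /=; apply: eq_bigr => -[j /= lt_ji] _.
rewrite !coef_poly (leq_trans lt_ji lt_in).
by rewrite (leq_ltn_trans (leq_subr _ _) lt_in).
Qed.

Lemma fps_trunc_mul n i x y : (i < n)%N ->
  (fps_trunc n (fps_mul x y))`_i = (fps_trunc n x * fps_trunc n y)`_i.
Proof. by move=> lt_in; rewrite coef_poly lt_in; exact: fps_mul_trunc. Qed.

Lemma fps_mulC : commutative fps_mul.
Proof.
by move=> x y; apply: fpsP => i; rewrite !(@fps_mul_trunc i.+1) // mulrC.
Qed.

Lemma fps_mulA : associative fps_mul.
Proof.
move=> x y z; apply: fpsP => i; rewrite !(@fps_mul_trunc i.+1) //.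
transitivity (fps_trunc i.+1 x * (fps_trunc i.+1 y * fps_trunc i.+1 z))`_i.
  rewrite !coefM; apply: eq_bigr => j _; congr (_ * _).
  by rewrite fps_trunc_mul // ltnS leq_subr.
rewrite mulrA !coefM; apply: eq_bigr => j _; congr (_ * _).
by rewrite fps_trunc_mul.
Qed.

Lemma fps_mul1 : left_id (fps_const 1) fps_mul.
Proof.
move=> x; apply: fpsP => i /=; rewrite big_ord_recl /= mul1r subn0.
by rewrite big1 ?addr0 // => j _; rewrite mul0r.
Qed.

Lemma fps_mulDl : left_distributive fps_mul fps_add.
Proof.
move=> x y z; apply: fpsP => i /=; rewrite -big_split /=.
by apply: eq_bigr => j _; rewrite mulrDl.
Qed.

Lemma fps_one_neq0 : fps_const 1 != 0.
Proof.
apply/eqP => /(congr1 (fun x => fcoef x 0)) /= /eqP.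
by rewrite oner_eq0.
Qed.

HB.instance Definition _ := GRing.Zmodule_isComNzRing.Build (fps R)
  fps_mulA fps_mulC fps_mul1 fps_mulDl fps_one_neq0.

End FpsRing.

Arguments fps_var {R}.

Section FpsTheory.
Variable R : comNzRingType.
Implicit Types (x y : fps R) (c : R).

Lemma fcoef0 n : fcoef (0 : fps R) n = 0.
Proof. exact: if_same. Qed.

Lemma fcoefD x y n : fcoef (x + y) n = fcoef x n + fcoef y n.
Proof. by []. Qed.

Lemma fcoefM x y n :
  fcoef (x * y) n = \sum_(i < n.+1) fcoef x i * fcoef y (n - i).
Proof. by []. Qed.

Lemma fcoef_constM c x n : fcoef (fps_const c * x) n = c * fcoef x n.
Proof.
rewrite fcoefM big_ord_recl /= subn0 big1 ?addr0 // => i _.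
by rewrite mul0r.
Qed.

Lemma fcoef_varX m n : fcoef (fps_var ^+ m : fps R) n = (n == m)%:R.
Proof.
elim: m n => [|m IHm] n; first by rewrite expr0 /=; case: eqP.
rewrite exprS fcoefM; case: n => [|n].
  by rewrite big_ord_recl big_ord0 mul0r addr0.
rewrite big_ord_recl /= mul0r add0r big_ord_recl /= mul1r subSS subn0 IHm.
by rewrite big1 ?addr0 // => i _; rewrite mul0r.
Qed.

Lemma fps_const_nmod : nmod_morphism (@fps_const R).
Proof. by split; [|move=> a b]; apply: fpsP => -[|i] //=; rewrite addr0. Qed.

Lemma fps_const_monoid : monoid_morphism (@fps_const R).
Proof.
split=> // a b; apply: fpsP => i; rewrite fcoef_constM /=.
by case: eqP; rewrite ?mulr0.
Qed.

HB.instance Definition _ := GRing.isNmodMorphism.Build R (fps R) (@fps_const R)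
  fps_const_nmod.
HB.instance Definition _ := GRing.isMonoidMorphism.Build R (fps R)
  (@fps_const R) fps_const_monoid.

Definition fps_const_term x : R := fcoef x 0.

Lemma fps_const_term_nmod : nmod_morphism fps_const_term.
Proof. by []. Qed.

Lemma fps_const_term_monoid : monoid_morphism fps_const_term.
Proof.
by split=> // x y; rewrite /fps_const_term fcoefM big_ord_recl big_ord0 addr0.
Qed.

HB.instance Definition _ := GRing.isNmodMorphism.Build (fps R) R fps_const_term
  fps_const_term_nmod.
HB.instance Definition _ := GRing.isMonoidMorphism.Build (fps R) R
  fps_const_term fps_const_term_monoid.
End FpsTheory.

Section FpsUnitRing.
Variable R : comUnitRingType.
Implicit Types x y z : fps R.

Definition fps_unit : {pred fps R} := fun x => fcoef x 0 \is a GRing.unit.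

Fixpoint fps_inv_seq x n : seq R :=
  if n is m.+1 then
    let s := fps_inv_seq x m in
    rcons s ((fcoef x 0)^-1 * ((m == 0%N)%:R
                               - \sum_(i < m) fcoef x (m - i) * s`_i))
  else [::].

Definition fps_inv x :=
  if fps_unit x then Fps (fun n => (fps_inv_seq x n.+1)`_n) else x.

Lemma size_fps_inv_seq x n : size (fps_inv_seq x n) = n.
Proof. by elim: n => //= n IHn; rewrite size_rcons IHn. Qed.

Lemma nth_fps_inv_seq x n i : (i < n)%N ->
  (fps_inv_seq x n)`_i = (fps_inv_seq x i.+1)`_i.
Proof.
elim: n => // n IHn; rewrite ltnS leq_eqVlt => /orP[/eqP->//|lt_in].
by rewrite [LHS]nth_rcons size_fps_inv_seq lt_in; apply: IHn.
Qed.

Lemma fps_mulV : {in fps_unit, left_inverse 1 fps_inv *%R}.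
Proof.
move=> x ux; rewrite mulrC; apply: fpsP => n.
rewrite /fps_inv (_ : fps_unit x) //=.
rewrite (reindex_inj rev_ord_inj) /= big_ord_recr /= subSS subnn.
rewrite subn0 nth_rcons size_fps_inv_seq ltnn eqxx mulrA divrr // mul1r.
rewrite [X in X + _](_ : _ = \sum_(i < n)
    fcoef x (n - i) * (fps_inv_seq x n)`_i).
  by rewrite addrCA subrr addr0; case: eqP.
apply: eq_bigr => -[i /= lt_in] _; rewrite subSS subKn 1?ltnW //.
by congr (_ * _); rewrite (nth_fps_inv_seq x lt_in).
Qed.

Lemma fps_unitPl x y : y * x = 1 -> fps_unit x.
Proof.
move=> /(congr1 (fun z => fcoef z 0)) /=.
rewrite big_ord_recl big_ord0 addr0 /= => yx1.
by apply/unitrPr; exists (fcoef y 0); rewrite mulrC.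
Qed.

Lemma fps_inv_out : {in [predC fps_unit], fps_inv =1 id}.
Proof. by move=> x nux; rewrite /fps_inv ifN. Qed.

HB.instance Definition _ := GRing.ComNzRing_hasMulInverse.Build (fps R)
  fps_mulV fps_unitPl fps_inv_out.

End FpsUnitRing.

(* R[[u1, u2, u3]] is represented as R[[u1]][[u2]][[u3]]. *)
Definition fps3 (R : comUnitRingType) : comUnitRingType := fps (fps (fps R)).

Section Fps3.
Variable R : comUnitRingType.

Definition const3 (c : R) : fps3 R := fps_const (fps_const (fps_const c)).
Definition u1 : fps3 R := fps_const (fps_const fps_var).
Definition u2 : fps3 R := fps_const fps_var.
Definition u3 : fps3 R := fps_var.

(* The coefficient of u1^a u2^b u3^c. *)
Definition coef3 (x : fps3 R) (a b c : nat) : R :=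
  fcoef (fcoef (fcoef x c) b) a.

(* The formal sum of a family in which every monomial has a nonzero           *)
(* coefficient in only finitely many members; the \sum_(i \in A) of fsbigop   *)
(* is the sum over the finite support.                                        *)
Definition sum3 (I : choiceType) (F : I -> fps3 R) : fps3 R :=
  Fps (fun c => Fps (fun b => Fps (fun a =>
    \sum_(i \in [set: I]) coef3 (F i) a b c))).

End Fps3.

Arguments u1 {R}.
Arguments u2 {R}.
Arguments u3 {R}.

Lemma coef3_monomial (R : comUnitRingType) (x : R) i j m a b c :
  coef3 (const3 x * u1 ^+ i * u2 ^+ j * u3 ^+ m) a b c
  = if [&& i == a, j == b & m == c] then x else 0.
Proof.
rewrite /coef3 /const3 /u1 /u2 /u3 -!rmorphXn -!rmorphM !fcoef_constM.
rewrite fcoef_varX eq_sym; case: (m =P c) => _; last first.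
  by rewrite mulr0 ?fcoef0 !andbF.
rewrite mulr1 fcoef_constM fcoef_varX eq_sym; case: (j =P b) => _; last first.
  by rewrite mulr0 ?fcoef0 !andbF.
rewrite mulr1 fcoef_constM fcoef_varX eq_sym !andbT.
by case: (i =P a); rewrite ?mulr1 ?mulr0.
Qed.

Section MultipleHarmonicQSeries.
Variable F : fieldType.
Implicit Types (n k l s : nat) (q : F) (kk : seq nat).

Definition multi_index kk : bool := all (leq 1) kk.
Definition weight kk : nat := sumn kk.
Definition depth kk : nat := size kk.
Definition height kk : nat := count (leq 2) kk.

(* The path condition reads n > m_1 > ... > m_l > 0. *)
Definition zbar n kk q : F :=
  \sum_(m : (depth kk).-tuple 'I_n | path gtn n (rcons (map val m) 0%N))
    \prod_(i < depth kk)
      (q ^+ ((nth 0 kk i - 1) * tnth m i)%N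
         / (1 - q ^+ tnth m i) ^+ nth 0%N kk i).

(* All the (k_1 [] k_2 [] ... [] k_l), listed with multiplicity, where k_1 is *)
(* the first argument, kk = (k_2, ..., k_l), and each [] is replaced by       *)
(* a comma, by + or by -1+.                                                   *)
Fixpoint fillings (k1 : nat) kk : seq (seq nat) :=
  if kk is k2 :: kk' then
    [seq k1 :: p | p <- fillings k2 kk']
      ++ fillings (k1 + k2) kk'
      ++ fillings (k1 - 1 + k2) kk'
  else [:: [:: k1]].

Lemma size_fillings k1 kk : size (fillings k1 kk) = (3 ^ size kk)%N.
Proof.
elim: kk k1 => //= k2 kk IHk k1.
by rewrite !size_cat size_map !IHk expnS !mulSn addn0.
Qed.

(* A polynomial in the interpolation parameter t, here 'X. Only nonempty      *)
(* indices are meaningful.                                                    *)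
Definition zbar_t n kk q : {poly F} :=
  if kk is k1 :: kk' then
    \sum_(p <- fillings k1 kk') (zbar n p q)%:P * 'X^(depth kk - depth p)
  else 0.

(* The entries of a multi-index of weight k are at most k. *)
Definition G n k l s q : {poly F} :=
  if [&& k == 0%N, l == 0%N & s == 0%N] then 1 else
  \sum_(x : l.-tuple 'I_k.+1
        | let kk := map val x in
          [&& multi_index kk, weight kk == k & height kk == s])
    zbar_t n (map val x) q.

Definition genG n q : fps3 {poly F} :=
  sum3 (fun i : nat * nat * nat => let: (k, l, s) := i in
    const3 (G n k l s q) * u1 ^+ (k - l - s) * u2 ^+ (l - s) * u3 ^+ s).

Lemma depth_height_le kk :
  multi_index kk -> (depth kk + height kk <= weight kk)%N.
Proof.
rewrite /height /weight /depth; elim: kk => //= a kk IHk /andP[a_gt0 /IHk le_k].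
rewrite addSn addnCA -addnS addnC -addSn addnC.
have: (1 + (2 <= a) <= a)%N by case: a a_gt0 => [|[]].
lia.
Qed.

(* Hence the truncated subtractions in genG are harmless. *)
Lemma G_eq0 n k l s q : ~~ ((l + s <= k) && (s <= l))%N -> G n k l s q = 0.
Proof.
rewrite /G; case: and3P => [[/eqP-> /eqP-> /eqP->]//|_] nle.
rewrite big1 // => x /and3P[kk /eqP wk /eqP hs].
have szx : depth (map val x) = l by rewrite /depth size_map size_tuple.
case/negP: nle; rewrite -wk -hs -[X in (X + _)%N]szx depth_height_le //=.
by rewrite -[X in (_ <= X)%N]szx count_size.
Qed.

End MultipleHarmonicQSeries.

Lemma coef3_genG (F : fieldType) n (q : F) a b c :
  coef3 (genG n q) a b c = G n (a + b + c + c) (b + c) c q.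
Proof.
rewrite {1}/coef3 /genG /sum3 /=.
rewrite -(fsbig_widen [set (a + b + c + c, b + c, c)%N] setT) //=.
  rewrite fsbig_set1 coef3_monomial ifT //; apply/and3P; split; apply/eqP; lia.
move=> [[k l] s] /= [_ ne]; rewrite coef3_monomial; case: and3P => // -[/eqP e1 /eqP e2 /eqP e3].
have [/andP[le1 le2]|/G_eq0 -> //] := boolP ((l + s <= k) && (s <= l))%N.
case: ne; congr (_, _, _); lia.
Qed.

Definition U (A : comUnitRingType) (n : nat) (t u1 u2 u3 : A) : A :=
  \sum_(a < n) \sum_(b < n | (a + b <= n - 1)%N)
    (n - a - b)%:R^-1 * 'C(n - a - 1, b)%:R * 'C(n - b - 1, a)%:R
      * t ^+ (n - a - b - 1) * (1 + u1) ^+ a * (1 - t * u2) ^+ b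
      * (u3 - u1 * u2) ^+ (n - a - b - 1).

Lemma rmorph_U (A B : comUnitRingType) (f : {rmorphism A -> B}) n
    (t v1 v2 v3 : A) :
  (forall m, m.+1%:R \is a @GRing.unit A) ->
  f v1 = 0 -> f v2 = 0 -> f v3 = 0 -> f (U n t v1 v2 v3) = n%:R.
Proof.
move=> natU f1 f2 f3.
rewrite /U rmorph_sum -[in RHS](card_ord n) -sumr_const.
apply: eq_bigr => -[a lt_an] _ /=; rewrite rmorph_sum /=.
have lt_b : (n - a - 1 < n)%N by lia.
rewrite (bigD1 (Ordinal lt_b)) /=; last by lia.
rewrite big1 => [|[b lt_bn] /andP[/= le_ab ne_b]].
  have -> : (n - a - (n - a - 1) = 1)%N by lia.
  have -> : (n - (n - a - 1) - 1 = a)%N by lia.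
  rewrite subnn !binn !expr0 mulr1n invr1 !mulr1 mul1r rmorphM.
  rewrite (rmorphXn f a) (rmorphXn f (n - a - 1)).
  rewrite (rmorphD f 1) (rmorphB f 1) (rmorphM f t).
  by rewrite (rmorph1 f) f1 f2 mulr0 subr0 !addr0 !expr1n mulr1.
have {}ne_b : b != (n - a - 1)%N by [].
have -> : (n - a - b - 1 = (n - a - b - 2).+1)%N by lia.
rewrite rmorphM [X in _ * X]rmorphXn /= (rmorphB f v3) (rmorphM f v1) f1 f3.
by rewrite mul0r subr0 expr0n mulr0.
Qed.

(* Hence U^{t-1} / U^t is a genuine quotient over a Q-algebra. *)
Lemma U_unit (R : comUnitRingType) n (t : fps3 R) :
  (forall m, m.+1%:R \is a @GRing.unit R) -> (0 < n)%N ->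
  U n t u1 u2 u3 \is a GRing.unit.
Proof.
move=> natU n_gt0.
have [ct [unitE ct1 ct2 ct3]] : exists ct : {rmorphism fps3 R -> R},
  [/\ forall x, (x \is a GRing.unit) = (ct x \is a GRing.unit),
      ct u1 = 0, ct u2 = 0 & ct u3 = 0].
  by exists (@fps_const_term R \o (@fps_const_term (fps R)
              \o @fps_const_term (fps (fps R)))).
have natU3 m : (m.+1%:R : fps3 R) \is a GRing.unit by rewrite unitE rmorph_nat.
by rewrite unitE (rmorph_U _ _ natU3 ct1 ct2 ct3) -(prednK n_gt0).
Qed.

(* Main.v *)
(* At a root of unity Q, put x = 1 / (1 - Q) and y = Q / (1 - Q) = x - 1, so   *)
(* that an entry k contributes x y ^ (k - 1).  Then the contributions of       *)
(* k_1 + k_2 and k_1 - 1 + k_2 add up to the product of those of k_1 and k_2,  *)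
(* so merging r entries with both signs multiplies their contributions and     *)
(* gives a factor t ^ (r - 1).  The generating function is therefore the       *)
(* product over 0 < m < n of (1 - (t - 1) phi_m) / (1 - t phi_m), where phi_m  *)
(* is the generating function of a single entry.  Up to a factor free of t,    *)
(* 1 - t phi_m is the quadratic A Q ^ 2 - (A + B + C) Q + B at Q = zeta ^ m,   *)
(* with A = 1 + u1, B = 1 - t u2, C = t (u3 - u1 u2).  Its product over all    *)
(* n-th roots of unity is A ^ n + B ^ n - (X ^ n + Y ^ n), where X and Y are   *)
(* the roots of T ^ 2 - (A + B + C) T + A B, and the power sum X ^ n + Y ^ n   *)
(* equals A ^ n + B ^ n + n C U_n^t.  The root Q = 1 accounts for - C.         *)

Require Import Defs.
From mathcomp Require Import all_boot all_algebra.
From mathcomp Require Import reals complex.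
From mathcomp Require Import zify ring.

Import GRing.Theory.

Local Open Scope ring_scope.

(** Write [X_n] for the generating series [genG n]. Raising the cut from [m] to [m + 1] changes an
    interpolated sum only through the block merged at [m_1 = m] ([zbar_t1S]). Summed over all
    indices, this reads [X_(m+1) - X_m = phi_m (t X_(m+1) - (t - 1) X_m)] ([genGS]), and it
    telescopes to the product formula [genG_prod]. Clearing denominators free of [t] ([K_phi])
    leaves products of one quadratic at the powers of [zeta]. Such a product over all roots of unity
    is governed by a power sum of the roots of the quadratic ([prod_roots_quadratic]), and [U_hsum]
    expresses that power sum through [U_n^t], using a closed form for complete homogeneous sums. The
    root [Q = 1] contributes [- C], which is cancelled as a non-zero-divisor ([prod_quad_U]). The
    factor [n] is common to numerator and denominator, and [U_unit] justifies the final division. *)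

(** * Two-by-two matrices and the product of a quadratic over the roots of unity *)

Lemma lift2_0 : lift (ord0 : 'I_2) ord0 = 1.
Proof. exact: val_inj. Qed.

Lemma det_mx2 (R : comNzRingType) (M : 'M[R]_2) :
  \det M = M 0 0 * M 1 1 - M 0 1 * M 1 0.
Proof.
rewrite (expand_det_row _ ord0) !big_ord_recl big_ord0 /cofactor !det_mx11.
rewrite !mxE lift2_0 (_ : lift 1 0 = ord0); last exact: val_inj.
by rewrite addr0 expr0 expr1 mul1r mulN1r mulrN.
Qed.

Lemma trace_mx2 (R : comNzRingType) (M : 'M[R]_2) : \tr M = M 0 0 + M 1 1.
Proof. by rewrite /mxtrace !big_ord_recl big_ord0 addr0 lift2_0. Qed.

Lemma mul_mx2E (R : comNzRingType) (M N : 'M[R]_2) i j :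
  (M * N) i j = M i 0 * N 0 j + M i 1 * N 1 j.
Proof. by rewrite mxE !big_ord_recl big_ord0 addr0 lift2_0. Qed.

Lemma det_mx2_sub1 (R : comNzRingType) (M : 'M[R]_2) :
  \det (M - 1) = \det M - \tr M + 1.
Proof. by rewrite !det_mx2 trace_mx2 !mxE /=; ring. Qed.

(** Cayley-Hamilton, multiplied by [M ^+ n] and traced. *)
Lemma trace_mx2_exp (R : comNzRingType) (M : 'M[R]_2) n :
  \tr (M ^+ n.+2) = \tr M * \tr (M ^+ n.+1) - \det M * \tr (M ^+ n).
Proof.
rewrite !exprS; set N := M ^+ n.
by rewrite det_mx2 !trace_mx2 !mul_mx2E; ring.
Qed.

(** Traces of its powers replace the power sums of the roots of [x ^ 2 - s x + d], so no extension
    of [R] containing the roots is required. *)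
Definition companion2 {R : comNzRingType} (s d : R) : 'M[R]_2 :=
  \matrix_(i, j) if i == 0 then (if j == 0 then s else - d) else (j == 0)%:R.

Lemma det_companion2_sub {R : comNzRingType} (s d x : R) :
  \det (companion2 s d - x%:M) = x ^+ 2 - s * x + d.
Proof. by rewrite det_mx2 !mxE /=; ring. Qed.

Lemma trace_companion2 {R : comNzRingType} (s d : R) :
  \tr (companion2 s d) = s.
Proof. by rewrite trace_mx2 !mxE /=; ring. Qed.

Lemma det_companion2 {R : comNzRingType} (s d : R) :
  \det (companion2 s d) = d.
Proof. by rewrite det_mx2 !mxE /=; ring. Qed.

(* The quadratic is [det (M - x)] for the companion matrix [M], so the        *)
(* product is [det (M ^ n - 1)].                                              *)
Lemma prod_roots_quadratic {R : comNzRingType} (s d z : R) n :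
  \prod_(0 <= i < n) ('X - (z ^+ i)%:P) = 'X^n - 1 :> {poly R} ->
  \prod_(0 <= i < n) ((z ^+ i) ^+ 2 - s * z ^+ i + d)
  = d ^+ n - \tr (companion2 s d ^+ n) + 1.
Proof.
move=> /(congr1 (horner_mx (companion2 s d))) e.
have -> : \prod_(0 <= i < n) ((z ^+ i) ^+ 2 - s * z ^+ i + d)
    = \det (\prod_(0 <= i < n) (companion2 s d - (z ^+ i)%:M)).
  elim/big_rec2: _ => [|i x M _ IH]; first by rewrite det1.
  by rewrite det_mulmx -IH det_companion2_sub.
have -> : \prod_(0 <= i < n) (companion2 s d - (z ^+ i)%:M)
          = companion2 s d ^+ n - 1.
  move: e; rewrite rmorph_prod rmorphB rmorphXn rmorph1 /= horner_mx_X => <-.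
  by apply: eq_bigr => i _; rewrite rmorphB /= horner_mx_X horner_mx_C.
rewrite det_mx2_sub1; congr (_ - _ + _).
elim: n {e} => [|n IH]; first by rewrite !expr0 det1.
by rewrite !exprS det_mulmx IH det_companion2.
Qed.

(** Both sides are [(k + r + 1)! / (k! r!)]. This is what absorbs the denominators [n - a - b] of
    [U]. *)
Lemma mul_succ_bin_sub k r :
  (k.+1 * 'C(k.+1 + r, k.+1) = r.+1 * 'C(k + r.+1, k))%N.
Proof. by rewrite mul_bin_left addSnnS; congr (_ * _)%N; lia. Qed.

Lemma bin_succ_add k r :
  'C(k.+1 + r.+1, k.+1) = ('C(k.+1 + r, k.+1) + 'C(k + r.+1, k))%N.
Proof. by rewrite addSn binS !addSn addnS. Qed.

(** * A closed form for the complete homogeneous sums of the two roots *)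

Section QuadraticSum.
Variable R : comNzRingType.
Variables A B C : R.

(* [hsum n] is the complete homogeneous symmetric polynomial of degree [n] of *)
(* the roots of [X ^ 2 - (A + B + C) X + A B].  The binomials vanish when     *)
(* [n < a + b], where the exponent of [C] is truncated.                       *)
Definition hterm (n a b : nat) : R :=
  ('C(n - b, a) * 'C(n - a, b))%:R * A ^+ a * B ^+ b * C ^+ (n - a - b).

Definition hsum n : R := \sum_(0 <= a < n.+1) \sum_(0 <= b < n.+1) hterm n a b.

Lemma hterm_eq0 n a b : (n < a + b)%N -> hterm n a b = 0.
Proof.
move=> lt; rewrite /hterm.
have [le|lt'] := leqP b n.
  by rewrite bin_small ?mul0r //; lia.
by rewrite (bin_small (n := n - a)) ?muln0 ?mul0r //; lia.
Qed.

(** Since the terms vanish beyond the triangle, index shifts may change the box of summation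
    freely. *)
Lemma hsum_box n m1 m2 : (n < m1)%N -> (n < m2)%N ->
  \sum_(0 <= a < m1) \sum_(0 <= b < m2) hterm n a b = hsum n.
Proof.
move=> lt1 lt2; rewrite (@big_cat_nat _ _ _ n.+1) //=.
rewrite [X in _ + X]big_nat_cond [X in _ + X]big1 ?addr0; last first.
  by move=> a /andP[] /andP[? ?] _; apply: big1 => b _; apply: hterm_eq0; lia.
apply: eq_bigr => a _; rewrite (@big_cat_nat _ _ _ n.+1) //=.
rewrite [X in _ + X]big_nat_cond [X in _ + X]big1 ?addr0 //.
by move=> b /andP[] /andP[? ?] _; apply: hterm_eq0; lia.
Qed.

Lemma sum_box_recl (T : nat -> nat -> R) m :
  \sum_(0 <= a < m.+1) \sum_(0 <= b < m.+1) T a b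
  = T 0%N 0%N + \sum_(0 <= a < m) T a.+1 0%N + \sum_(0 <= b < m) T 0%N b.+1
    + \sum_(0 <= a < m) \sum_(0 <= b < m) T a.+1 b.+1.
Proof.
rewrite big_nat_recl // big_nat_recl //.
under [X in _ + X]eq_bigr => a _ do rewrite big_nat_recl //.
by rewrite big_split /=; ring.
Qed.

Lemma sum_box_recl1 (T : nat -> nat -> R) m1 m2 :
  \sum_(0 <= a < m1) \sum_(0 <= b < m2.+1) T a b
  = \sum_(0 <= a < m1) T a 0%N + \sum_(0 <= a < m1) \sum_(0 <= b < m2) T a b.+1.
Proof.
under eq_bigr => a _ do rewrite big_nat_recl //.
by rewrite big_split.
Qed.

Lemma sum_box_recl2 (T : nat -> nat -> R) m1 m2 :
  \sum_(0 <= a < m1.+1) \sum_(0 <= b < m2) T a b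
  = \sum_(0 <= b < m2) T 0%N b + \sum_(0 <= a < m1) \sum_(0 <= b < m2) T a.+1 b.
Proof. by rewrite big_nat_recl. Qed.

Lemma htermE n a b r : (n = a + b + r)%N ->
  hterm n a b = ('C(a + r, a) * 'C(b + r, b))%:R * A ^+ a * B ^+ b * C ^+ r.
Proof.
move=> ->; rewrite /hterm (_ : (a + b + r - b = a + r)%N); last by lia.
by rewrite (_ : (a + b + r - a = b + r)%N) ?addKn //; lia.
Qed.

(** By Pascal's rule the two binomials are [x + y] and [x' + y'], and the identity is [(x + y)(x' +
    y') = y (x' + y') + (x + y) y' + x x' - y y']. On the border [n = a + b] the [C] term
    vanishes. *)
Lemma htermSS n a b :
  hterm n.+2 a.+1 b.+1 = A * hterm n.+1 a b.+1 + B * hterm n.+1 a.+1 b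
    + C * hterm n.+1 a.+1 b.+1 - A * B * hterm n a b.
Proof.
have [lt|le] := ltnP n (a + b).
  by rewrite !hterm_eq0 ?mulr0 ?subr0 ?addr0 //; lia.
have [[|r] ->] : exists r, (n = a + b + r)%N by exists (n - (a + b))%N; lia.
  rewrite (@htermE _ _ _ 0) 1?(@htermE _ a b.+1 0) 1?(@htermE _ a.+1 b 0);
    try lia.
  rewrite (@htermE _ a b 0) 1?(@hterm_eq0 _ a.+1 b.+1); try lia.
  by rewrite !addn0 !binn muln1 !exprS; ring.
rewrite (@htermE _ _ _ r.+1) 1?(@htermE _ a b.+1 r.+1); try lia.
rewrite (@htermE _ a.+1 b r.+1) 1?(@htermE _ a b r.+1); try lia.
rewrite (@htermE _ a.+1 b.+1 r); try lia.
by rewrite !bin_succ_add !natrM !natrD !exprS; ring.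
Qed.

Lemma htermS0 n a :
  hterm n.+2 a.+1 0 = A * hterm n.+1 a 0 + C * hterm n.+1 a.+1 0.
Proof.
have [lt|le] := ltnP n.+1 a.
  by rewrite !hterm_eq0 ?mulr0 ?addr0 //; lia.
have [[|r] ->] : exists r, (n.+1 = a + r)%N by exists (n.+1 - a)%N; lia.
  rewrite addn0 (@htermE _ _ _ 0) 1?(@htermE _ a 0 0); try lia.
  by rewrite (@hterm_eq0 _ a.+1 0) ?addn0 ?binn ?bin0 ?muln1 ?exprS; [ring|lia].
rewrite (@htermE _ _ _ r.+1) 1?(@htermE _ a 0 r.+1); try lia.
rewrite (@htermE _ a.+1 0 r); last by lia.
by rewrite bin_succ_add !bin0 !muln1 !natrD !exprS; ring.
Qed.

Lemma hterm0S n b :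
  hterm n.+2 0 b.+1 = B * hterm n.+1 0 b + C * hterm n.+1 0 b.+1.
Proof.
have [lt|le] := ltnP n.+1 b.
  by rewrite !hterm_eq0 ?mulr0 ?addr0 //; lia.
have [[|r] ->] : exists r, (n.+1 = b + r)%N by exists (n.+1 - b)%N; lia.
  rewrite addn0 (@htermE _ _ _ 0) 1?(@htermE _ 0 b 0); try lia.
  by rewrite (@hterm_eq0 _ 0 b.+1) ?addn0 ?binn ?bin0 ?muln1 ?exprS; [ring|lia].
rewrite (@htermE _ _ _ r.+1) 1?(@htermE _ 0 b r.+1); try lia.
rewrite (@htermE _ 0 b.+1 r); last by lia.
by rewrite bin_succ_add !bin0 !mul1n !natrD !exprS; ring.
Qed.

Lemma hterm00 n : hterm n 0 0 = C ^+ n.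
Proof. by rewrite /hterm !bin0 !subn0 !mulr1 mul1r. Qed.

Lemma hsum0 : hsum 0 = 1.
Proof. by rewrite /hsum !big_nat1 hterm00. Qed.

Lemma hsum1 : hsum 1 = A + B + C.
Proof.
rewrite /hsum !big_nat_recr //= !big_geq // /hterm /=.
rewrite !subn0 !subnn !bin0 bin1 bin_small //.
by rewrite !muln1 !expr0 !expr1; ring.
Qed.

Lemma hsumSS n : hsum n.+2 = (A + B + C) * hsum n.+1 - A * B * hsum n.
Proof.
have [m lt] : exists m, (n.+1 < m)%N by exists n.+2.
rewrite -(@hsum_box n.+2 m.+1 m.+1) ?ltnS // sum_box_recl.
under eq_bigr => a _ do rewrite htermS0.
under [X in _ + X + _]eq_bigr => b _ do rewrite hterm0S.
under [X in _ + X]eq_bigr => a _ do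
  (under eq_bigr => b _ do rewrite htermSS;
   rewrite sumrB !big_split /= -!mulr_sumr).
rewrite sumrB !big_split /= -!mulr_sumr (@hsum_box n m m) ?(ltnW lt) //.
(* With the edges included, the [C] terms fill an [m.+1] by [m.+1] box, the [A] terms an [m] by
   [m.+1] box and the [B] terms an [m.+1] by [m] box. Each of these sums to [hsum n.+1]. *)
have := @hsum_box n.+1 m.+1 m.+1 (ltnW lt) (ltnW lt).
rewrite sum_box_recl => e.
have := @hsum_box n.+1 m m.+1 lt (ltnW lt); rewrite sum_box_recl1 => e1.
have := @hsum_box n.+1 m.+1 m (ltnW lt) lt; rewrite sum_box_recl2 => e2.
rewrite !hterm00 in e *.
rewrite 2!mulrDl -{1}e1 -{1}e2 -{1}e [C ^+ n.+2]exprS; ring.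
Qed.

End QuadraticSum.

Arguments hterm {R}.
Arguments hsum {R}.

(** * [U] as a power sum of the roots *)

Section CoefficientsOfU.
Variable R : comUnitRingType.
Hypothesis nat_unit : forall m, m.+1%:R \is a @GRing.unit R.
Variables t v1 v2 v3 : R.
Let A := 1 + v1.
Let B := 1 - t * v2.
Let C := t * (v3 - v1 * v2).

(** The terms of [n C U_n^t]: the extra [C] completes its exponent to [n - a - b], and the value 0
    off the triangle allows sums over boxes. *)
Definition Uterm n a b : R :=
  if (a + b < n)%N then
    n%:R * ((n - a - b)%:R^-1 * ('C(n - a - 1, b) * 'C(n - b - 1, a))%:R)
      * A ^+ a * B ^+ b * C ^+ (n - a - b)
  else 0.

Lemma Uterm_eq0 n a b : (n <= a + b)%N -> Uterm n a b = 0.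
Proof. by rewrite /Uterm; case: ltnP. Qed.

Lemma sum_Uterm n m : (n <= m)%N -> (0 < n)%N ->
  \sum_(0 <= a < m) \sum_(0 <= b < m) Uterm n a b
  = n%:R * C * U n t v1 v2 v3.
Proof.
move=> le_nm n_gt0; rewrite /U mulr_sumr -(big_mkord xpredT (fun a => n%:R * C *
  \sum_(b < n | (a + b <= n - 1)%N)
    ((n - a - b)%:R^-1 * 'C(n - a - 1, b)%:R * 'C(n - b - 1, a)%:R
      * t ^+ (n - a - b - 1) * (1 + v1) ^+ a * (1 - t * v2) ^+ b
      * (v3 - v1 * v2) ^+ (n - a - b - 1)))).
rewrite (@big_cat_nat _ _ _ n) //=.
rewrite [X in _ + X]big_nat_cond [X in _ + X]big1 ?addr0; last first.
  move=> a /andP[] /andP[le_na _] _; apply: big1 => b _.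
  by apply: Uterm_eq0; lia.
apply: eq_bigr => a _; rewrite (@big_cat_nat _ _ _ n) //=.
rewrite [X in _ + X]big_nat_cond [X in _ + X]big1 ?addr0; last first.
  by move=> b /andP[] /andP[le_nb _] _; apply: Uterm_eq0; lia.
rewrite big_mkord mulr_sumr [RHS]big_mkcond; apply: eq_bigr => b _.
rewrite /Uterm; case: ifP => lt; case: ifP => // le; try lia.
have : (n - a - b = (n - a - b - 1).+1)%N by lia.
move: (n - a - b - 1)%N => r ->; rewrite /A /B /C exprS natrM exprMn; ring.
Qed.

Lemma natr_divE k r x d : (k * x = r.+1 * d)%N ->
  k%:R * (r.+1%:R^-1 * x%:R) = d%:R :> R.
Proof.
by move=> e; rewrite mulrCA -natrM e natrM mulrA mulVr ?mul1r.
Qed.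

(** In the notation [x + y], [x' + y'] for Pascal's rule, [(a + 1) x = (r + 1) y] and
    [(b + 1) x' = (r + 1) y'] turn [(a + b + r + 3) x x'] into [(r + 1)(x x' + x y' + y x')], and
    the last factor is [(x + y)(x' + y') - y y']. *)
Lemma UtermSS n a b :
  Uterm n.+2 a.+1 b.+1 = hterm A B C n.+2 a.+1 b.+1 - A * B * hterm A B C n a b.
Proof.
have [le|lt] := ltnP (a + b) n; last first.
  rewrite Uterm_eq0; last by lia.
  have [->|lt'] := eqVneq n (a + b)%N.
    rewrite (@htermE _ _ _ _ _ _ _ 0) 1?(@htermE _ _ _ _ _ a b 0); try lia.
    by rewrite !addn0 !binn muln1 !exprS; ring.
  by rewrite !hterm_eq0 ?mulr0 ?subr0 //; lia.
have [r ->] : exists r, (n = a + b + r.+1)%N by exists (n - (a + b)).-1%N; lia.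
rewrite (@htermE _ _ _ _ _ _ _ r.+1) 1?(@htermE _ _ _ _ _ a b r.+1); try lia.
rewrite /Uterm ifT; last by lia.
rewrite (_ : _ - a.+1 - b.+1 = r.+1)%N; last by lia.
rewrite (_ : _ - a.+1 - 1 = b.+1 + r)%N; last by lia.
rewrite (_ : _ - b.+1 - 1 = a.+1 + r)%N; last by lia.
rewrite (@natr_divE _ _ _ ('C(a.+1 + r.+1, a.+1) * 'C(b.+1 + r.+1, b.+1)
   - 'C(a + r.+1, a) * 'C(b + r.+1, b))); last first.
  have := mul_succ_bin_sub a r; have := mul_succ_bin_sub b r.
  rewrite !bin_succ_add; nia.
rewrite natrB; first by rewrite natrM !exprS; ring.
by rewrite !bin_succ_add leq_mul ?leq_addl.
Qed.

(** The corner [A ^+ n.+1] has [C]-exponent 0, so it occurs in [hterm] but not in [Uterm]; it yields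
    the [A ^ n] of the power sum. *)
Lemma UtermS0 n a :
  Uterm n.+1 a.+1 0 + (if a == n then A ^+ n.+1 else 0)
  = hterm A B C n.+1 a.+1 0.
Proof.
have [lt|lt|->] := ltngtP a n.
- have [r ->] : exists r, (n = a + r.+1)%N by exists (n - a).-1%N; lia.
  rewrite (@htermE _ _ _ _ _ _ _ r.+1) ?addr0; try lia.
  rewrite /Uterm ifT; last by lia.
  rewrite (_ : _ - a.+1 - 0 = r.+1)%N; last by lia.
  rewrite (_ : _ - 0 - 1 = a.+1 + r)%N; last by lia.
  rewrite (@natr_divE _ _ _ 'C(a.+1 + r.+1, a.+1)) ?bin0 ?muln1 //.
  have := mul_succ_bin_sub a r; rewrite !bin_succ_add; nia.
- by rewrite Uterm_eq0 ?hterm_eq0 ?addr0 //; lia.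
rewrite Uterm_eq0 1?(@htermE _ _ _ _ _ _ _ 0); try lia.
by rewrite !addn0 !binn; ring.
Qed.

Lemma Uterm0S n b :
  Uterm n.+1 0 b.+1 + (if b == n then B ^+ n.+1 else 0)
  = hterm A B C n.+1 0 b.+1.
Proof.
have [lt|lt|->] := ltngtP b n.
- have [r ->] : exists r, (n = b + r.+1)%N by exists (n - b).-1%N; lia.
  rewrite (@htermE _ _ _ _ _ _ _ r.+1) ?addr0; try lia.
  rewrite /Uterm ifT; last by lia.
  rewrite (_ : _ - 0 - b.+1 = r.+1)%N; last by lia.
  rewrite (_ : _ - 0 - 1 = b.+1 + r)%N; last by lia.
  rewrite (@natr_divE _ _ _ 'C(b.+1 + r.+1, b.+1)) ?bin0 ?muln1 ?mul1n //.
  have := mul_succ_bin_sub b r; rewrite !bin_succ_add; nia.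
- by rewrite Uterm_eq0 ?hterm_eq0 ?addr0 //; lia.
rewrite Uterm_eq0 1?(@htermE _ _ _ _ _ _ _ 0); try lia.
by rewrite !addn0 !binn; ring.
Qed.

Lemma Uterm00 n : Uterm n.+1 0 0 = C ^+ n.+1.
Proof. by rewrite /Uterm /= !bin0 !subn0 !mulr1 mulrV // mul1r. Qed.

(** For roots [X], [Y] with [X Y = A B], the right-hand side is [h_N - X Y h_(N-2) = X ^ N + Y ^ N]
    with [N = n + 2]. *)
Lemma U_hsum n :
  n.+2%:R * C * U n.+2 t v1 v2 v3 + A ^+ n.+2 + B ^+ n.+2
  = hsum A B C n.+2 - A * B * hsum A B C n.
Proof.
rewrite -(@sum_Uterm _ n.+3) // -(@hsum_box _ _ _ _ n.+2 n.+3 n.+3) //.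
rewrite -(@hsum_box _ _ _ _ n n.+2 n.+2); try lia.
rewrite (@sum_box_recl _ (Uterm n.+2)) (@sum_box_recl _ (hterm A B C n.+2)).
rewrite Uterm00 hterm00.
have delta (x : R) : \sum_(0 <= a < n.+2) (if a == n.+1 then x else 0) = x.
  rewrite big_nat_recr //= eqxx big_nat_cond big1 ?add0r // => a.
  by rewrite andbT => /andP[_ lt]; rewrite ltn_eqF.
under [X in _ = _ + X + _ + _ - _]eq_bigr => a _ do rewrite -UtermS0.
under [X in _ = _ + _ + X + _ - _]eq_bigr => b _ do rewrite -Uterm0S.
rewrite !big_split /= !delta.
under [X in _ + X + _ + _ = _]eq_bigr => a _ do
  (under eq_bigr => b _ do rewrite UtermSS; rewrite sumrB -mulr_sumr).
rewrite sumrB -mulr_sumr; ring.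
Qed.

Lemma U1 : U 1 t v1 v2 v3 = 1.
Proof.
rewrite /U !big_ord_recl !big_ord0 /= !big_mkcond /= !big_ord_recl !big_ord0 /=.
by rewrite !addr0 invr1 !mulr1.
Qed.

(** The eigenvalues of the companion matrix are [X / A] and [Y / A]. Both sides obey the same
    second-order recurrence, hence the induction on two consecutive degrees. *)
Lemma hsum_trace n :
  A \is a GRing.unit ->
  A ^+ n.+2 * \tr (companion2 ((A + B + C) / A) (B / A) ^+ n.+2)
  = hsum A B C n.+2 - A * B * hsum A B C n.
Proof.
move=> uA; pose s := (A + B + C) / A; pose d := B / A.
pose p n := \tr (companion2 s d ^+ n).
have sA : A * s = A + B + C by rewrite mulrC divrK.
have dA : A * d = B by rewrite mulrC divrK.
have pSS k : p k.+2 = s * p k.+1 - d * p k.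
  by rewrite /p trace_mx2_exp trace_companion2 det_companion2.
have p0 : p 0%N = 2%:R by rewrite /p expr0 mxtrace1.
have p1 : p 1%N = s by rewrite /p expr1 trace_companion2.
suff [] : A ^+ n.+2 * p n.+2 = hsum A B C n.+2 - A * B * hsum A B C n
   /\ A ^+ n.+3 * p n.+3 = hsum A B C n.+3 - A * B * hsum A B C n.+1 by [].
elim: n => [|n [IH1 IH2]].
  rewrite !pSS p0 p1 !hsumSS hsum1 hsum0 -sA -dA.
  by split; ring.
split=> //.
have -> : A ^+ n.+4 * p n.+4
    = (A * s) * (A ^+ n.+3 * p n.+3) - A * (A * d) * (A ^+ n.+2 * p n.+2).
  by rewrite pSS !exprS; ring.
rewrite IH1 IH2 sA dA !(hsumSS _ _ _ _ n.+2) (hsumSS _ _ _ _ n); ring.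
Qed.

(** Dividing by [A] makes the quadratic monic; the product is then
    [B ^ n - (X ^ n + Y ^ n) + A ^ n], in which [A ^ n] and [B ^ n] cancel by [U_hsum]. *)
Lemma prod_roots_U n z :
  (0 < n)%N -> A \is a GRing.unit ->
  \prod_(0 <= i < n) ('X - (z ^+ i)%:P) = 'X^n - 1 :> {poly R} ->
  \prod_(0 <= i < n) (A * (z ^+ i) ^+ 2 - (A + B + C) * z ^+ i + B)
  = - (n%:R * C * U n t v1 v2 v3).
Proof.
move=> n_gt0 uA prim.
pose s := (A + B + C) / A; pose d := B / A.
have sA : A * s = A + B + C by rewrite mulrC divrK.
have dA : A * d = B by rewrite mulrC divrK.
rewrite (eq_bigr (fun i => A * ((z ^+ i) ^+ 2 - s * z ^+ i + d))) => [|i _];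
  last by rewrite -sA -dA; ring.
rewrite big_split /= prod_roots_quadratic // prodr_const_nat subn0.
case: n n_gt0 {prim} => [//|[|n]] _.
  by rewrite U1 !expr1 trace_companion2 2!mulrDr mulrN sA dA; ring.
rewrite 2!mulrDr mulrN hsum_trace // -U_hsum -exprMn dA; ring.
Qed.

End CoefficientsOfU.

(** * Recursion in [n] for the interpolated sums *)

Lemma sum_tuple_cons (V : nmodType) (T : finType) l (P : pred (l.+1.-tuple T))
    (E : l.+1.-tuple T -> V) :
  \sum_(x | P x) E x
  = \sum_(i : T) \sum_(y : l.-tuple T | P (cons_tuple i y)) E (cons_tuple i y).
Proof.
rewrite pair_big_dep /=.
rewrite (reindex (fun p : T * l.-tuple T => cons_tuple p.1 p.2)) //=.
exists (fun x => (thead x, behead_tuple x)) => [[i y] _ | x _] /=.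
  by congr (_, _); apply: val_inj.
by rewrite [RHS]tuple_eta; apply: val_inj.
Qed.

Section Zbar.
Variables (F : fieldType) (q : F).

Definition zweight (m k : nat) : F := q ^+ ((k - 1) * m)%N / (1 - q ^+ m) ^+ k.

(** The value at the empty index vanishes for [n = 0], as the final comparison with 0 in the path
    condition demands. *)
Fixpoint zbar_rec (n : nat) (kk : seq nat) : F :=
  if kk is k :: kk' then \sum_(0 <= m < n | (0 < m)%N) zweight m k * zbar_rec m kk'
  else (0 < n)%:R.

Lemma zbar_recE n kk : zbar n kk q = zbar_rec n kk.
Proof.
(* A fixed bound [K] on the entries lets the induction lower [n] without changing the type of the
   tuples. *)
suff H K : (n <= K)%N ->
  \sum_(m : (depth kk).-tuple 'I_K | path gtn n (rcons (map val m) 0%N))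
    \prod_(i < depth kk) zweight (tnth m i) (nth 0%N kk i) = zbar_rec n kk.
  exact: (H n).
elim: kk n => [|k kk IH] n le_nK /=.
  rewrite (big_mkcond _) (big_pred1 [tuple]) => [|m]; last by rewrite [m]tuple0.
  by rewrite big_ord0 /= andbT; case: ltnP.
rewrite [LHS](@sum_tuple_cons F 'I_K (size kk)).
transitivity (\sum_(i < K | (i < n)%N && (0 < i)%N) zweight i k * zbar_rec i kk).
  rewrite [RHS]big_mkcond; apply: eq_bigr => i _.
  have [lt_in|le_ni] /= := ltnP i n; last first.
    by rewrite big_pred0 // => y /=; rewrite ltnNge le_ni.
  rewrite (eq_bigl (fun y : (depth kk).-tuple 'I_K =>
    path gtn i (rcons (map val y) 0%N))) => [|y]; last by rewrite /= lt_in.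
  rewrite (eq_bigr (fun y : (depth kk).-tuple 'I_K => zweight i k *
    \prod_(j < depth kk) zweight (tnth y j) (nth 0%N kk j))) => [|y _].
    rewrite -mulr_sumr IH ?(ltnW (ltn_ord i)) //.
    by case: posnP => // ->; case: (kk) => [|? ?] /=; rewrite ?big_geq ?mulr0.
  rewrite big_ord_recl tnth0 /=; congr (_ * _).
  by apply: eq_bigr => j _; rewrite tnthS.
rewrite big_mkord (big_ord_widen_cond _ (fun i => (0 < i)%N)
  (fun i => zweight i k * zbar_rec i kk) le_nK).
by apply: eq_bigl => i; rewrite andbC.
Qed.

Lemma zbarS n k kk : (0 < n)%N ->
  zbar n.+1 (k :: kk) q = zbar n (k :: kk) q + zweight n k * zbar n kk q.
Proof.
move=> n_gt0; rewrite !zbar_recE /= big_mkcond big_nat_recr //=.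
by rewrite -big_mkcond ifT.
Qed.

(** With [x = 1 / (1 - q ^ m)] and [y = x - 1], an entry weighs [x y ^ (k - 1)], and [y + 1 = x]. *)
Lemma zweight_merge m k1 k2 : q ^+ m != 1 -> (0 < k1)%N -> (0 < k2)%N ->
  zweight m (k1 + k2) + zweight m (k1 - 1 + k2) = zweight m k1 * zweight m k2.
Proof.
case: k1 => // k1; case: k2 => // k2; rewrite eq_sym -subr_eq0 => nz _ _.
rewrite /zweight addSn addnS !subn1 /= addnS /= mulSn mulnDl.
rewrite !exprS !exprD; field.
by rewrite nz !expf_neq0.
Qed.

Lemma size_fillings_le k kk p : p \in fillings k kk -> (size p <= (size kk).+1)%N.
Proof.
elim: kk k p => [|k2 kk IH] k p /=; first by rewrite inE => /eqP->.
rewrite !mem_cat => /or3P[/mapP[r /IH le ->]|/IH le|/IH le] //=; exact: ltnW.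
Qed.

(** Fillings are sorted by their first box; either merging costs one unit of depth, hence the factor
    ['X]. *)
Lemma zbar_t_cons n k1 k2 kk :
  zbar_t n (k1 :: k2 :: kk) q
  = \sum_(p <- fillings k2 kk) (zbar n (k1 :: p) q)%:P * 'X^((size kk).+1 - size p)
    + 'X * (zbar_t n (k1 + k2 :: kk)%N q + zbar_t n (k1 - 1 + k2 :: kk)%N q).
Proof.
have shift k : \sum_(p <- fillings k kk) (zbar n p q)%:P * 'X^((size kk).+2 - size p)
   = 'X * zbar_t n (k :: kk) q.
  rewrite /zbar_t mulr_sumr; apply: eq_big_seq => p /size_fillings_le le.
  by rewrite /depth /= subSn // exprS mulrCA.
by rewrite /zbar_t /depth /= !big_cat big_map /= !shift mulrDr.
Qed.

(** The value 1 at the empty index ends the recursion and agrees with [G_n^t(0,0,0) = 1]. *)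
Definition zbar_t1 n kk : {poly F} := if kk is [::] then 1 else zbar_t n kk q.

(* Splitting off the block that is merged at [m_1 = n] gives a recursion in   *)
(* [n] that removes a single entry of the index.                              *)
Lemma zbar_t1S n k kk : (0 < n)%N -> q ^+ n != 1 -> multi_index (k :: kk) ->
  zbar_t1 n.+1 (k :: kk) - zbar_t1 n (k :: kk)
  = (zweight n k)%:P * ('X * zbar_t1 n.+1 kk - ('X - 1) * zbar_t1 n kk).
Proof.
move=> n_gt0 qn; elim: kk k => [|k2 kk IH] k1.
  move=> _; rewrite /= !big_seq1 zbarS // (zbar_recE n [::]) /= n_gt0.
  by rewrite polyCD polyCM subnn expr0 polyC1; ring.
move=> pos; have /and3P[k1_gt0 k2_gt0 kk_gt0] := pos.
have zE m j jj : zbar_t1 m (j :: jj) = zbar_t m (j :: jj) q by [].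
rewrite !zE !zbar_t_cons.
have e : \sum_(p <- fillings k2 kk)
       (zbar n.+1 (k1 :: p) q)%:P * 'X^((size kk).+1 - size p)
   = \sum_(p <- fillings k2 kk)
       (zbar n (k1 :: p) q)%:P * 'X^((size kk).+1 - size p)
     + (zweight n k1)%:P * zbar_t n (k2 :: kk) q.
  rewrite /zbar_t mulr_sumr -big_split; apply: eq_bigr => p _ /=.
  by rewrite zbarS // polyCD polyCM mulrDl mulrA.
set V := 'X * zbar_t1 n.+1 kk - ('X - 1) * zbar_t1 n kk in IH.
have {}IH j : (0 < j)%N ->
    zbar_t n.+1 (j :: kk) q - zbar_t n (j :: kk) q = (zweight n j)%:P * V.
  by move=> j_gt0; apply: IH; rewrite /= j_gt0.
have := zweight_merge _ _ _ qn k1_gt0 k2_gt0 => /(congr1 polyC).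
rewrite polyCD (polyCM (zweight n k1)) => ew.
(* The first summand is the change from a comma in the first box. The others come from induction on
   the merged first entries, both positive; [zweight_merge] then factors out the weight of [k1]. *)
transitivity ((zweight n k1)%:P * zbar_t n (k2 :: kk) q
   + 'X * ((zweight n (k1 + k2))%:P * V + (zweight n (k1 - 1 + k2))%:P * V)).
  rewrite e -!IH ?addn_gt0 ?k1_gt0 ?k2_gt0 ?orbT //.
  have alg (S X a b c d z : {poly F}) :
    S + z + X * (a + b) - (S + X * (c + d)) = z + X * (a - c + (b - d)) by ring.
  exact: alg.
rewrite -mulrDl ew -(mulrA _ _ V) -IH //.
have alg (a b c X : {poly F}) : a * c + X * (a * (b - c)) = a * (X * b - (X - 1) * c)
  by ring.
exact: alg.
Qed.

End Zbar.

Arguments zweight {F}.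
Arguments zbar_t1 {F}.

(** * Sums over indices of given weight, depth and height *)

Section IndexSum.
Variable V : nmodType.

(** The bound [K] is independent of the weight [k], so removing the first entry keeps the range of
    the others. *)
Definition index_sum (f : seq nat -> V) (K l k s : nat) : V :=
  \sum_(x : l.-tuple 'I_K
        | let kk := map val x in
          [&& multi_index kk, weight kk == k & height kk == s]) f (map val x).

Lemma index_sum0 f K k s :
  index_sum f K 0 k s = if (k == 0%N) && (s == 0%N) then f [::] else 0.
Proof.
rewrite /index_sum (big_mkcond _) (big_pred1 [tuple]) => [|m].
  by rewrite /= ![0%N == _]eq_sym.
by rewrite [m]tuple0.
Qed.

Lemma index_sumS f K l k s :
  index_sum f K l.+1 k s
  = \sum_(0 <= j < K | [&& (0 < j)%N, (j <= k)%N & ((1 < j) <= s)%N])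
      index_sum (fun kk => f (j :: kk)) K l (k - j) (s - (1 < j)).
Proof.
rewrite /index_sum sum_tuple_cons big_mkord [RHS]big_mkcond; apply: eq_bigr => i _ /=.
case: ifP => [/and3P[i_gt0 le_ik le_s]|ncond].
  apply: eq_bigl => y; rewrite /= i_gt0 /=; congr (_ && _); congr (_ && _).
    by rewrite /weight /=; lia.
  by rewrite /height /=; lia.
rewrite big_pred0 // => y; apply/negP => /and3P[/= /andP[i_gt0 _]].
rewrite /weight /height /= => e1 e2.
by move: ncond; rewrite i_gt0 /=; lia.
Qed.

Lemma index_sum_bound f K l k s :
  (k < K)%N -> index_sum f K l k s = index_sum f k.+1 l k s.
Proof.
elim: l f k s K => [|l IH] f k s K lt_kK; first by rewrite !index_sum0.
rewrite !index_sumS (@big_cat_nat _ _ _ k.+1) //= [X in _ + X]big_nat_cond.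
rewrite [X in _ + X]big_pred0 ?addr0 => [|j]; last by lia.
apply: eq_bigr => j /and3P[j_gt0 le_jk _].
by rewrite IH 1?[RHS]IH //; lia.
Qed.

End IndexSum.

Arguments index_sum {V}.

Section Generating.
Variables (F : fieldType) (q : F).

Lemma G_index_sum n k l s : G n k l s q = index_sum (zbar_t1 q n) k.+1 l k s.
Proof.
rewrite /G; case: l => [|l].
  rewrite index_sum0 andTb; case: ifP => // /negP nks.
  rewrite big_pred0 // => x; rewrite [x]tuple0 /=.
  by apply/negP => /andP[e1 e2]; apply: nks; rewrite ![_ == 0%N]eq_sym e1.
rewrite /= andbF; apply: eq_bigr => x _.
by case/tupleP: x.
Qed.

Lemma GS n k l s : (0 < n)%N -> q ^+ n != 1 ->
  G n.+1 k l.+1 s q - G n k l.+1 s q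
  = \sum_(0 <= j < k.+1 | (0 < j)%N && ((1 < j) <= s)%N)
      (zweight q n j)%:P * ('X * G n.+1 (k - j) l (s - (1 < j)) q
                            - ('X - 1) * G n (k - j) l (s - (1 < j)) q).
Proof.
move=> n_gt0 qn; rewrite !G_index_sum !index_sumS -sumrB.
rewrite big_nat_cond [RHS]big_nat_cond; apply: eq_big => [j|j]; first by lia.
case/andP=> /andP[_ lt_jk] /and3P[j_gt0 le_jk le_s].
rewrite !G_index_sum -!(@index_sum_bound _ _ k.+1 l (k - j)); try lia.
rewrite /index_sum -sumrB !mulr_sumr -sumrB mulr_sumr.
apply: eq_bigr => x /and3P[pos _ _].
by rewrite zbar_t1S //= j_gt0.
Qed.

End Generating.

(** * Coefficients of products in three variables *)

Section Coef3.
Variable R : comUnitRingType.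
Implicit Types x y : fps3 R.

Lemma fps3P x y : (forall a b c, coef3 x a b c = coef3 y a b c) -> x = y.
Proof. by move=> e; do 3!(apply: fpsP => ?); apply: e. Qed.

Lemma coef3D x y a b c : coef3 (x + y) a b c = coef3 x a b c + coef3 y a b c.
Proof. by []. Qed.

Lemma coef3N x a b c : coef3 (- x) a b c = - coef3 x a b c.
Proof. by []. Qed.

Lemma coef3_constM r x a b c : coef3 (const3 r * x) a b c = r * coef3 x a b c.
Proof. by rewrite /coef3 !fcoef_constM. Qed.

Lemma coef3_interp r x y a b c :
  coef3 (const3 r * x - (const3 r - 1) * y) a b c
  = r * coef3 x a b c - (r - 1) * coef3 y a b c.
Proof.
rewrite coef3D coef3_constM; congr (_ + _).
rewrite coef3N (_ : (const3 r - 1) * y = const3 r * y - y); last first.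
  by move: (const3 r) => z; rewrite mulrBl mul1r.
rewrite coef3D coef3_constM coef3N.
by rewrite mulrBl mul1r.
Qed.

Lemma fcoef_varM (A : comNzRingType) (x : fps A) n :
  fcoef (fps_var * x) n = if n is m.+1 then fcoef x m else 0.
Proof.
case: n => [|n]; first by rewrite fcoefM big_ord1 mul0r.
rewrite fcoefM big_ord_recl mul0r add0r big_ord_recl mul1r subSS subn0.
by rewrite big1 ?addr0 // => i _; rewrite mul0r.
Qed.

Lemma coef3_u2M x a b c :
  coef3 (u2 * x) a b c = if b is b'.+1 then coef3 x a b' c else 0.
Proof.
by rewrite /coef3 fcoef_constM fcoef_varM; case: b => [|b]; rewrite ?fcoef0.
Qed.

Lemma coef3_u3M x a b c :
  coef3 (u3 * x) a b c = if c is c'.+1 then coef3 x a b c' else 0.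
Proof. by rewrite /coef3 fcoef_varM; case: c => [|c]; rewrite ?fcoef0. Qed.

Lemma coef3_series1M (p : fps R) x a b c :
  coef3 (fps_const (fps_const p) * x) a b c
  = \sum_(0 <= i < a.+1) fcoef p i * coef3 x (a - i) b c.
Proof. by rewrite /coef3 !fcoef_constM fcoefM big_mkord. Qed.

Lemma coef3_linM r (p : fps R) x a b c :
  coef3 ((const3 r * u2 + u3 * fps_const (fps_const p)) * x) a b c
  = r * (if b is b'.+1 then coef3 x a b' c else 0)
    + (if c is c'.+1 then \sum_(0 <= i < a.+1) fcoef p i * coef3 x (a - i) b c'
       else 0).
Proof.
rewrite (_ : _ * x = const3 r * (u2 * x) + u3 * (fps_const (fps_const p) * x)).
  rewrite coef3D; congr (_ + _).
    by apply: etrans (coef3_constM _ _ _ _ _) _; rewrite coef3_u2M.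
  apply: etrans (coef3_u3M _ _ _ _) _; case: c => // c.
  exact: coef3_series1M.
move: (const3 r) u2 u3 (fps_const (fps_const p)) => z w y s.
by rewrite mulrDl !mulrA.
Qed.

End Coef3.

(** * The recursion for the generating series and its product formula *)

Section Recursion.
Variables (F : fieldType) (q : F).

(* The generating series of the contributions of a single entry at [m = n].   *)
Definition phi n : fps3 {poly F} :=
  const3 (zweight q n 1)%:P * u2
  + u3 * fps_const (fps_const (Fps (fun i => (zweight q n i.+2)%:P))).

Lemma genGS n : (0 < n)%N -> q ^+ n != 1 ->
  genG n.+1 q - genG n q
  = phi n * (const3 'X * genG n.+1 q - (const3 'X - 1) * genG n q).
Proof.
move=> n_gt0 qn.
(* Unless the two series are generalized, unification unfolds fps_mul and     *)
(* does not come back.                                                        *)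
move: (genG n.+1 q) (genG n q) (coef3_genG n.+1 q) (coef3_genG n q).
move=> X1 X0 X1E X0E.
pose v k l s : {poly F} := 'X * G n.+1 k l s q - ('X - 1) * G n k l s q.
have := coef3_interp _ 'X X1 X0.
move: (_ - _ * X0) => W WE'.
have {WE'} WE a b c : coef3 W a b c = v (a + b + c + c)%N (b + c)%N c.
  by rewrite WE' X1E X0E.
have v0 k l s : ~~ ((l + s <= k) && (s <= l))%N -> v k l s = 0.
  by move=> no; rewrite /v !G_eq0 // !mulr0 subrr.
apply: fps3P => a b c; rewrite coef3D coef3N X1E X0E.
rewrite coef3_linM.
have [/andP[/eqP-> /eqP->]|nbc] := boolP ((b == 0%N) && (c == 0%N)).
  rewrite /= mulr0 addr0 !G_index_sum !index_sum0.
  exact: subrr.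
have [l lE] : exists l, (b + c = l.+1)%N by exists (b + c).-1; lia.
rewrite lE GS //; set k := (a + b + c + c)%N.
have [k' kE] : exists k', (k = k'.+1)%N by exists k.-1; lia.
(* The first entry [j = 1] has height 0 and matches the [u2] part of [phi]; [j = i + 2] matches
   [u3 u1 ^ i]. *)
rewrite big_mkcond kE big_nat_recl // big_nat_recl //= add0r; congr (_ + _).
  congr (_ * _); rewrite subn0 -/(v _ _ _); case: b => [|b] in nbc lE k kE *.
    by apply: v0; lia.
  by rewrite WE; congr v; lia.
case: c => [|c] in nbc lE k kE *; first by rewrite big1.
(* For [i > a] the remaining weight is below depth plus height, so those terms vanish. *)
rewrite (@big_cat_nat _ _ _ a.+1) //=; last by lia.
rewrite [X in _ + X]big_nat_cond [X in _ + X]big1 ?addr0 => [|i]; last first.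
  by rewrite andbT => /andP[? ?]; rewrite -/(v _ _ _) v0 ?mulr0 //; lia.
rewrite big_nat [RHS]big_nat; apply: eq_bigr => i lt_ia.
by rewrite WE -/(v _ _ _); congr (_ * v _ _ _); lia.
Qed.

Lemma fillings_neq0 k kk p : p \in fillings k kk -> p != [::].
Proof.
elim: kk k p => [|k2 kk IH] k p /=; first by rewrite inE => /eqP->.
by rewrite !mem_cat => /or3P[/mapP[r _ ->]|/IH|/IH].
Qed.

Lemma zbar_t1_1 k kk : zbar_t1 q 1 (k :: kk) = 0.
Proof.
rewrite /= big_seq big1 // => -[|j p] /fillings_neq0 // _.
by rewrite zbar_recE /= big_mkcond big_nat1 /= mul0r.
Qed.

Lemma genG1 : genG 1 q = 1.
Proof.
apply: fps3P => a b c; rewrite coef3_genG G_index_sum.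
case: (posnP (b + c)) => [|lt].
  case: b => [|b] //; case: c => [|c] // _; rewrite index_sum0 !addn0 andbT.
  by case: a.
have -> : coef3 1 a b c = 0 :> {poly F}.
  case: c lt => [|c] lt; last first.
    rewrite /coef3 (_ : fcoef _ c.+1 = 0); last by [].
    by rewrite !fcoef0.
  case: b lt => // b _; rewrite /coef3 (_ : fcoef _ b.+1 = 0); last by [].
  by rewrite fcoef0.
rewrite /index_sum big1 // => x _; move: lt x; case: (b + c)%N => // l _ x.
by case/tupleP: x => i x; rewrite zbar_t1_1.
Qed.

(** The step says [(1 - t f_m) X_(m+1) = (1 - (t - 1) f_m) X_m], which telescopes without
    division. *)
Lemma prod_of_step (R : comNzRingType) (X f : nat -> R) (t : R) n :
  (0 < n)%N -> X 1%N = 1 ->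
  (forall m, (0 < m < n)%N ->
     X m.+1 - X m = f m * (t * X m.+1 - (t - 1) * X m)) ->
  X n * \prod_(1 <= m < n) (1 - t * f m)
  = \prod_(1 <= m < n) (1 - (t - 1) * f m).
Proof.
move=> n_gt0 X1 step; elim: n n_gt0 step => // -[|n] IH _ step.
  by rewrite !big_geq // X1 mulr1.
rewrite [in LHS]big_nat_recr // [in RHS]big_nat_recr //= -IH //; last first.
  by move=> m /andP[m_gt0 lt_m]; rewrite step // m_gt0 ltnW.
set P := \prod_(_ <= _ < _) _.
have -> : X n.+2 * (P * (1 - t * f n.+1))
    = P * (X n.+2 - X n.+1 - f n.+1 * (t * X n.+2 - (t - 1) * X n.+1))
      + X n.+1 * P * (1 - (t - 1) * f n.+1) by ring.
by rewrite step ?leqnn // subrr mulr0 add0r.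
Qed.

Lemma genG_prod n : (0 < n)%N -> (forall m, (0 < m < n)%N -> q ^+ m != 1) ->
  genG n q * \prod_(1 <= m < n) (1 - const3 'X * phi m)
  = \prod_(1 <= m < n) (1 - (const3 'X - 1) * phi m).
Proof.
move=> n_gt0 qm; apply: (@prod_of_step _ (fun m => genG m q)) => //.
  exact: genG1.
by move=> m lt_m; apply: genGS (qm m lt_m); case/andP: lt_m.
Qed.

End Recursion.

Arguments phi {F}.

(** * Non-zero-divisors and units among the series *)

Section Regular.
Variable R : comNzRingType.

(** If [x y = 0], the coefficients of [y] vanish one after another. This matters because
    [C = t (u3 - u1 u2)] has to be cancelled but is not invertible. *)
Lemma fps_lreg (x : fps R) : GRing.lreg (fcoef x 0) -> GRing.lreg x.
Proof.
move=> reg; apply: mulrI0_lreg => y /(congr1 (@fcoef R)) xy.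
apply: fpsP => n; rewrite fcoef0.
elim/ltn_ind: n => n IH; apply: reg; rewrite mulr0.
have := congr1 (fun f => f n) xy; rewrite fcoefM fcoef0 big_ord_recl subn0.
rewrite big1 ?addr0 // => i _; rewrite IH ?mulr0 // lift0.
by have := ltn_ord i; lia.
Qed.

Lemma fps_const_lreg (c : R) : GRing.lreg c -> GRing.lreg (fps_const c).
Proof. by move=> reg; apply: fps_lreg. Qed.

Lemma fps_var_lreg : GRing.lreg (fps_var : fps R).
Proof.
apply: mulrI0_lreg => y e; apply: fpsP => n; rewrite fcoef0.
by have := congr1 (fun x => fcoef x n.+1) e; rewrite fcoef_varM fcoef0.
Qed.

End Regular.

Lemma u3_sub_u1u2_lreg (R : comUnitRingType) :
  GRing.lreg (u3 - u1 * u2 : fps3 R).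
Proof.
apply: fps_lreg.
have -> : fcoef (u3 - u1 * u2 : fps3 R) 0 = - (fps_const fps_var * fps_var).
  by rewrite /u1 /u2 -rmorphM fcoefD /= add0r.
apply: lregN; apply: lregM; last exact: fps_var_lreg.
exact/fps_const_lreg/fps_var_lreg.
Qed.

Lemma unit3E (R : comUnitRingType) (x : fps3 R) :
  (x \is a GRing.unit) = (coef3 x 0 0 0 \is a GRing.unit).
Proof. by []. Qed.

Lemma one_add_u1_unit (R : comUnitRingType) :
  1 + u1 \is a @GRing.unit (fps3 R).
Proof.
have e : coef3 (1 + u1 : fps3 R) 0 0 0 = 1.
  by apply: etrans (coef3D _ _ _ _ _ _) _; apply: addr0.
by have := unit3E R (1 + u1); rewrite e unitr1.
Qed.

(** * From the factors [1 - t phi_m] to the quadratic *)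

Section Quadratic.
Variables (F : fieldType) (z : F).

Definition quad {R : comNzRingType} (t v1 v2 v3 Q : R) : R :=
  (1 + v1) * Q ^+ 2
  - (1 + v1 + (1 - t * v2) + t * (v3 - v1 * v2)) * Q + (1 - t * v2).

Lemma const3_polyC_morph :
  exists g : {rmorphism F -> fps3 {poly F}}, forall x, g x = const3 x%:P.
Proof.
by exists (@fps_const (fps (fps {poly F}))
           \o (@fps_const (fps {poly F}) \o (@fps_const {poly F} \o @polyC F))).
Qed.

Let Q m : fps3 {poly F} := const3 (z ^+ m)%:P.
(* [K m] is [(1 - Q) ^ 2 (1 - u1 Q / (1 - Q))], the common denominator.       *)
Let K m : fps3 {poly F} := (1 - Q m) ^+ 2 - u1 * Q m * (1 - Q m).

Lemma zweightE m k : zweight z m k.+1 = (z ^+ m) ^+ k / (1 - z ^+ m) ^+ k.+1.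
Proof. by rewrite /zweight subn1 mulnC exprM. Qed.

(** A geometric series with first term [Q / (1 - Q) ^ 2] and ratio [u1 Q / (1 - Q)], where
    [Q = z ^ m]. *)
Lemma series1_geometric m : z ^+ m != 1 ->
  let c : fps {poly F} := fps_const (z ^+ m)%:P in
  ((1 - c) ^+ 2 - fps_var * c * (1 - c)) * Fps (fun i => (zweight z m i.+2)%:P)
  = c.
Proof.
rewrite eq_sym -subr_eq0 => + c; set s := Fps _.
have [b bE] : exists b, b = 1 - z ^+ m by exists (1 - z ^+ m).
rewrite -bE => nz.
have -> : ((1 - c) ^+ 2 - fps_var * c * (1 - c)) * s
    = fps_const (b ^+ 2)%:P * s - fps_var * (fps_const (z ^+ m * b)%:P * s).
  have morph (g : {rmorphism F -> fps {poly F}}) a x :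
    ((1 - g a) ^+ 2 - x * g a * (1 - g a)) * s
    = g ((1 - a) ^+ 2) * s - x * (g (a * (1 - a)) * s).
    rewrite rmorphXn rmorphM rmorphB rmorph1.
    by move: (g a) s => y s; ring.
  by rewrite bE; apply: (morph (@fps_const {poly F} \o @polyC F)).
apply: fpsP => n; rewrite fcoefD [fcoef (- _) n]/(- fcoef _ n) fcoef_varM.
rewrite fcoef_constM; case: n => [|n]; last rewrite fcoef_constM /=.
  rewrite /= subr0 -polyCM zweightE expr1 -bE; congr _%:P; field.
  exact: nz.
rewrite -!polyCM -polyCB !zweightE !exprS -polyC0 -bE; congr _%:P; field.
by rewrite nz expf_neq0.
Qed.

Lemma rmorph_geometric (A B : comNzRingType) (g : {rmorphism A -> B})
    (c x s : A) :
  ((1 - c) ^+ 2 - x * c * (1 - c)) * s = c ->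
  ((1 - g c) ^+ 2 - g x * g c * (1 - g c)) * g s = g c.
Proof.
by move=> /(congr1 g); rewrite !(rmorphXn, rmorphM, rmorphB, rmorph1).
Qed.

Lemma K_series m : z ^+ m != 1 ->
  K m * fps_const (fps_const (Fps (fun i => (zweight z m i.+2)%:P))) = Q m.
Proof.
move=> zm.
exact: (rmorph_geometric _ _
  (@fps_const (fps (fps {poly F})) \o @fps_const (fps {poly F})) _ _ _
  (series1_geometric m zm)).
Qed.

(** [K] times the [u2] part of [phi] is [1 - Q - u1 Q], and times the [u3] part it is [Q]. As [K] is
    free of [t], it serves both [t] and [t - 1]. *)
Lemma K_phi m (t : fps3 {poly F}) : z ^+ m != 1 ->
  K m * (1 - t * phi z m) = quad t u1 u2 u3 (Q m).
Proof.
move=> zm; rewrite /phi.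
have := K_series m zm.
have : (1 - Q m) * const3 (zweight z m 1)%:P = 1.
  have [g gE] := const3_polyC_morph; rewrite /Q -!gE.
  rewrite -[X in X - _](rmorph1 g) -rmorphB -rmorphM zweightE expr0 expr1 div1r.
  by rewrite divrr ?rmorph1 // unitfE subr_eq0 eq_sym.
rewrite /K /quad.
move: (const3 (zweight z m 1)%:P) (fps_const (fps_const _)) (Q m) u1 u2 u3.
move=> x s c v1 v2 v3 cx Ks.
transitivity ((1 - c) ^+ 2 - v1 * c * (1 - c)
  - t * v2 * ((1 - c) * x) * (1 - c - v1 * c)
  - t * v3 * (((1 - c) ^+ 2 - v1 * c * (1 - c)) * s)); first by ring.
by rewrite cx Ks; ring.
Qed.

Lemma genG_quad n : (0 < n)%N -> (forall m, (0 < m < n)%N -> z ^+ m != 1) ->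
  genG n z * \prod_(1 <= m < n) quad (const3 'X) u1 u2 u3 (Q m)
  = \prod_(1 <= m < n) quad (const3 'X - 1) u1 u2 u3 (Q m).
Proof.
move=> n_gt0 zm.
have quadE (t : fps3 {poly F}) : \prod_(1 <= m < n) quad t u1 u2 u3 (Q m)
    = \prod_(1 <= m < n) K m * \prod_(1 <= m < n) (1 - t * phi z m).
  rewrite -big_split; rewrite big_nat [RHS]big_nat; apply: eq_bigr => m lt_m.
  by rewrite /= K_phi ?zm.
have cancel (R : comNzRingType) (X L P P' S S' : R) :
    S = L * P -> S' = L * P' -> X * P = P' -> X * S = S'.
  by move=> -> -> <-; rewrite mulrCA.
exact: cancel (quadE _) (quadE _) (genG_prod _ z n n_gt0 zm).
Qed.

(** At [Q = 1] the quadratic equals [- C]; removing this factor from the full product [- n C U]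
    leaves [n U]. *)
Lemma prod_quad_U (R : comUnitRingType) (t v1 v2 v3 y : R) n :
  (forall m, m.+1%:R \is a @GRing.unit R) ->
  (0 < n)%N -> 1 + v1 \is a GRing.unit -> GRing.lreg (t * (v3 - v1 * v2)) ->
  \prod_(0 <= i < n) ('X - (y ^+ i)%:P) = 'X^n - 1 :> {poly R} ->
  \prod_(1 <= m < n) quad t v1 v2 v3 (y ^+ m) = n%:R * U n t v1 v2 v3.
Proof.
move=> natU n_gt0 uA reg prim; apply: reg.
have := @prod_roots_U R natU t v1 v2 v3 n y n_gt0 uA prim.
rewrite big_ltn // expr0 => e.
apply: oppr_inj; rewrite mulrCA mulrA -e -mulNr; congr (_ * _).
by rewrite expr1n; ring.
Qed.

End Quadratic.

(** * The quotient formula *)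

Theorem genG_quotient (F : fieldType) (z : F) n :
  (forall m, (m.+1%:R : F) != 0) -> (0 < n)%N -> n.-primitive_root z ->
  genG n z = U n (const3 'X - 1) u1 u2 u3 / U n (const3 'X) u1 u2 u3.
Proof.
move=> nat_neq0 n_gt0 prim; have [g gE] := const3_polyC_morph F.
have natUF m : (m.+1%:R : F) \is a GRing.unit by rewrite unitfE.
have natUp m : (m.+1%:R : {poly F}) \is a GRing.unit.
  by rewrite -(rmorph_nat (@polyC F)) rmorph_unit.
have natU m : (m.+1%:R : fps3 {poly F}) \is a GRing.unit.
  by rewrite -(rmorph_nat g) rmorph_unit.
have zm m : (0 < m < n)%N -> z ^+ m != 1.
  case/andP=> m_gt0 lt_mn; by rewrite -(prim_order_dvd prim) gtnNdvd.
have gz m : const3 (z ^+ m)%:P = g z ^+ m by rewrite -gE rmorphXn.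
have uA := one_add_u1_unit {poly F}.
have primg : \prod_(0 <= i < n) ('X - (g z ^+ i)%:P) = 'X^n - 1.
  have := congr1 (map_poly g) (factor_Xn_sub_1 prim).
  rewrite rmorph_prod rmorphB rmorph1 /= map_polyXn => <-.
  apply: eq_bigr => i _; rewrite rmorphB /= map_polyX map_polyC.
  by congr (_ - _%:P); rewrite -rmorphXn.
(* Here [p] is the constant term of [t], namely ['X] or ['X - 1]; being nonzero, it makes [t], and
   so [C], a non-zero-divisor. *)
have U_prod (p : {poly F}) (t : fps3 {poly F}) : p != 0 ->
    coef3 t 0 0 0 = p ->
    \prod_(1 <= m < n) quad t u1 u2 u3 (const3 (z ^+ m)%:P)
    = n%:R * U n t u1 u2 u3.
  move=> p_neq0 tE; under eq_bigr => m _ do rewrite gz.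
  apply: prod_quad_U => //; apply: lregM (@u3_sub_u1u2_lreg _).
  do 3!apply: fps_lreg; rewrite [fcoef _ _]tE; exact/lregP.
have quotient (R : comUnitRingType) (X S S' N V W : R) :
    X * S = S' -> S = N * V -> S' = N * W ->
    N \is a GRing.unit -> V \is a GRing.unit -> X = W / V.
  move=> e eS eS' uN uV; apply: (mulIr uV); rewrite divrK //.
  by apply: (mulrI uN); rewrite -eS' -e eS mulrCA.
apply: quotient (genG_quad F z n n_gt0 zm) (U_prod 'X _ _ _)
  (U_prod ('X - 1) _ _ _) _ (U_unit _ natUp n_gt0).
- by rewrite -size_poly_eq0 size_polyX.
- by [].
- by rewrite -polyC1 polyXsubC_eq0.
- by [].
by rewrite -(prednK n_gt0).
Qed.

Theorem theorem1p3 (R : realType) (n : nat) (hn : (0 < n)%N)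
    (zeta : R[i]) (hzeta : n.-primitive_root zeta) :
  genG n zeta
  = U n (const3 'X - 1) u1 u2 u3 / U n (const3 'X) u1 u2 u3
    :> fps3 {poly R[i]}.
Proof.
by apply: genG_quotient => // m; rewrite Num.Theory.pnatr_eq0.
Qed.
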